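(* Let $G$ be a finite group and let $p$ be a prime. Assume $\mathbf{O}_p(G)=1$. If $G$ is a pseudo $M_p$-group, then $G$ is solvable.
   Context: All groups are finite. $\mathrm{IBr}(G)$ denotes the set of irreducible Brauer characters of $G$ with respect to the prime $p$, $\psi^G$ denotes the induced Brauer character, and $\mathbf{O}_p(G)$ is the largest normal $p$-subgroup of $G$. For $\varphi\in\mathrm{IBr}(G)$ put $$S(\varphi)=\{\psi\in\mathrm{IBr}(H)\mid H\le G,\ \psi^G=\varphi\},$$ where $H$ ranges over all subgroups of $G$ (including $G$ itself). The Brauer character $\varphi$ is called pseudo monomial if $\gcd\{\psi(1)\mid\psi\in S(\varphi)\}=1$. The group $G$ is a pseudo $M_p$-group if every $\varphi\in\mathrm{IBr}(G)$ is pseudo monomial. *)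

(* Defs.v *)
From HB Require Import structures.
From mathcomp Require Export all_boot all_order all_fingroup all_algebra.
From mathcomp Require Export all_solvable all_field all_character.

Set Implicit Arguments.
Unset Strict Implicit.
Unset Printing Implicit Defensive.

Import Order.TTheory GRing.Theory Num.Theory.
Local Open Scope ring_scope.

(* The ring of all algebraic integers, as a type. *)
Record algint := AlgInt { algint_val :> algC; _ : algint_val \in Aint }.

HB.instance Definition _ := [isSub for algint_val].
HB.instance Definition _ := [Choice of algint by <:].
HB.instance Definition _ := [SubChoice_isSubComNzRing of algint by <:].

(* Brauer characters depend on the choice of a maximal ideal M, containing p,
   of the ring of algebraic integers.  Such an M is given here by the reduction
   map onto its residue field: the kernel of a surjective ring morphism onto a
   field of characteristic p is a maximal ideal containing p, and conversely. *)
Record mod_reduction (p : nat) := ModReduction {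
  residue : fieldType;
  red : {rmorphism algint -> residue};
  red_pchar : p \in [pchar residue];
  red_surj : forall a : residue, exists z : algint, red z = a
}.

Definition p'_root_of_unity (p : nat) (z : algC) : Prop :=
  exists2 m : nat, p^'.-nat m & z ^+ m = 1.

Section BrauerCharacters.

Variables (p : nat) (M : mod_reduction p) (gT : finGroupType).

(* A Brauer character is a function on the p-regular elements of G; it is
   encoded as the class function on G extending it by 0 to the other elements.
   With this convention 'Ind[G] restricts to the usual induction formula on
   p-regular elements, and vanishes elsewhere.
   In the p-regular case, z lists the p'-roots of unity that lift the
   eigenvalues of rG g, with multiplicity; reduction is injective on p'-roots
   of unity, so z is determined up to order. *)
Definition affords_brauer (G : {group gT}) (n : nat)
    (rG : mx_representation (residue M) G n) (phi : 'CF(G)) : Prop :=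
  forall g : gT, g \in G ->
    if (p^'.-elt g)%g then
      exists z : seq algint,
        [/\ {in z, forall a : algint, p'_root_of_unity p a},
            char_poly (rG g) = \prod_(a <- z) ('X - (red M a)%:P)
          & phi g = \sum_(a <- z) (a : algC)]
    else phi g = 0.

Definition IBr (G : {group gT}) (phi : 'CF(G)) : Prop :=
  exists (n : nat) (rG : mx_representation (residue M) G n),
    mx_irreducible rG /\ affords_brauer rG phi.

Definition induction_source (G : {group gT}) (phi : 'CF(G))
    (H : {group gT}) (psi : 'CF(H)) : Prop :=
  [/\ H \subset G, IBr psi & 'Ind[G] psi = phi].

Definition is_gcd (D : nat -> Prop) (d : nat) : Prop :=
  (forall n, D n -> d %| n)%N /\
  (forall e, (forall n, D n -> e %| n) -> e %| d)%N.

Definition pseudo_monomial (G : {group gT}) (phi : 'CF(G)) : Prop :=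
  is_gcd (fun n => exists (H : {group gT}) (psi : 'CF(H)),
            induction_source phi psi /\ psi 1%g = n%:R) 1.

Definition pseudo_Mp_group (G : {group gT}) : Prop :=
  forall phi : 'CF(G), IBr phi -> pseudo_monomial phi.

End BrauerCharacters.

(* Main.v *)
Require Import Defs.
From HB Require Import structures.

Set Implicit Arguments.
Unset Strict Implicit.
Unset Printing Implicit Defensive.

Import Order.TTheory GRing.Theory Num.Theory.
Local Open Scope ring_scope.

(* Taketa's argument, in characteristic p.  Let N be a perfect normal subgroup
   of G; by induction on n, N acts trivially on every irreducible module V of
   dimension n.  If the Brauer character of V is induced from that of W on H,
   then the permutation module on the cosets of H has dimension at most n and a
   trivial submodule, so (unless n = 1) its composition factors have dimension
   less than n and N acts trivially on them; being perfect, N acts trivially on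
   the permutation module, i.e., N <= H.
   Comparing traces, V is isomorphic to the module induced from W, so W is a
   submodule of the restriction of V to N.  By Clifford's theorem the dimension
   d of the simple submodules of this restriction divides dim W.  Hence d = 1
   when V is pseudo monomial, and N, being perfect, acts trivially on V.
   The composition factors of the regular module then give N = 1. *)

(* Structures have no eta-conversion: F has to be destructed for its extension
   to a closedFieldType to be convertible to it. *)
Lemma closed_axiom_closure_field (F : fieldType) :
  GRing.closed_field_axiom F -> forall gT, group_closure_field F gT.
Proof.
case: F => T c closedF gT; pose F : fieldType := GRing.Field.Pack c.
pose K : closedFieldType := HB.pack F (Field_isAlgClosed.Build F closedF).
exact: (@group_closure_closed_field K gT).
Qed.

Lemma closed_axiom_poly_normal (F : fieldType) :
    GRing.closed_field_axiom F ->
  forall p : {poly F}, {r | p = lead_coef p *: \prod_(z <- r) ('X - z%:P)}.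
Proof.
case: F => T c closedF p; pose F : fieldType := GRing.Field.Pack c.
pose K : closedFieldType := HB.pack F (Field_isAlgClosed.Build F closedF).
exact: (@closed_field_poly_normal K p).
Qed.

(** * Roots of characteristic polynomials, and Frobenius powers *)

Lemma size_char_poly_roots (R : comNzRingType) n (A : 'M[R]_n) (s : seq R) :
  char_poly A = \prod_(z <- s) ('X - z%:P) -> size s = n.
Proof.
move=> /(congr1 (fun q : {poly R} => size q)).
by rewrite size_char_poly size_prod_XsubC => -[].
Qed.

Lemma mxtrace_char_poly_roots (R : comNzRingType) n (A : 'M[R]_n) (s : seq R) :
  char_poly A = \prod_(z <- s) ('X - z%:P) -> \tr A = \sum_(z <- s) z.
Proof.
move=> def_p; have sz_s := size_char_poly_roots def_p.
have [n0 | n_gt0] := posnP n.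
  rewrite (size0nil (etrans sz_s n0)) big_nil /mxtrace big1 // => i.
  by have := ltn_ord i; rewrite {2}n0.
apply: oppr_inj; rewrite -char_poly_trace // def_p -sz_s coefPn_prod_XsubC //.
by rewrite sz_s -lt0n.
Qed.

Lemma exprB_pchar_comm (R : nzRingType) p k (a b : R) :
    p \in [pchar R] -> GRing.comm a b ->
  (a - b) ^+ (p ^ k) = a ^+ (p ^ k) - b ^+ (p ^ k).
Proof.
move=> charR cab; elim: k => [|k IHk]; first by rewrite !expn0 !expr1.
rewrite expnSr !exprM IHk -!(pFrobenius_autE charR) pFrobenius_autB_comm //.
exact/commrX/commr_sym/commrX/commr_sym.
Qed.

(** * Traces over an algebraically closed field *)

Section ClosedField.

Variables (F : fieldType) (closedF : GRing.closed_field_axiom F).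

Lemma char_poly_split n (A : 'M[F]_n) :
  {r | char_poly A = \prod_(z <- r) ('X - z%:P)}.
Proof.
have [r def_p] := closed_axiom_poly_normal closedF (char_poly A).
by exists r; rewrite {1}def_p (monicP (char_poly_monic A)) scale1r.
Qed.

Lemma mxtrace_nilpotent n (A : 'M[F]_n.+1) q : A ^+ q = 0 -> \tr A = 0.
Proof.
move=> Aq0; have [r def_p] := char_poly_split A.
rewrite (mxtrace_char_poly_roots def_p) big_seq big1 // => z r_z.
have: root (char_poly A) z by rewrite def_p root_prod_XsubC.
rewrite -eigenvalue_root_char => /eigenvalueP[v vA nz_v].
have vAk k : v *m A ^+ k = z ^+ k *: v.
  elim: k => [|k IHk]; first by rewrite !expr0 mulmx1 scale1r.
  by rewrite exprSr mulmxA IHk -scalemxAl vA scalerA -exprSr.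
have /esym/eqP := vAk q; rewrite Aq0 mulmx0 scaler_eq0 (negPf nz_v) orbF.
by rewrite expf_eq0 => /andP[_ /eqP].
Qed.

(** If [p ^ k] is the order of the p-part of [x], then [x] and its p'-part have the same [p ^ k]-th
    power. They commute, so in characteristic p the difference of their matrices is nilpotent. Thus
    Brauer characters, which only see p-regular elements, control all traces. *)
Lemma mxtrace_repr_constt p (gT : finGroupType) (G : {group gT}) n
    (rG : mx_representation F G n) x :
  p \in [pchar F] -> x \in G -> \tr (rG x) = \tr (rG (x.`_p^')%g).
Proof.
move=> charF Gx; have pr_p := pcharf_prime charF.
set s := (x.`_p^')%g.
have Gs : s \in G.
  by apply: subsetP (cycle_constt _ x); rewrite cycle_subG.
case: n rG => [|n] rG; first by rewrite /mxtrace !big_ord0.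
have charM : p \in [pchar 'M[F]_n.+1].
  by rewrite inE pr_p -scaler_nat (pcharf0 charF) scale0r eqxx.
have [k ord_u] := p_natP (p_elt_constt p x : p.-nat _).
have xs : (x ^+ (p ^ k) = s ^+ (p ^ k))%g.
  rewrite -{1}[x](consttC p) expgMn; last exact: commuteX2.
  by rewrite -ord_u expg_order mul1g.
have cxs : GRing.comm (rG x) (rG s).
  rewrite /GRing.comm -[LHS]/(_ *m _) -[RHS]/(_ *m _) -!repr_mxM //.
  have /cycleP[i def_s] := cycle_constt p^' x.
  by congr (rG _); rewrite /s def_s; apply: commuteX.
apply/eqP; rewrite -subr_eq0 -linearB /=; apply/eqP.
apply: (@mxtrace_nilpotent _ _ (p ^ k)).
by rewrite (exprB_pchar_comm k charM cxs) -!repr_mxX ?groupX // xs subrr.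
Qed.

End ClosedField.

(** * Perfect subgroups, Clifford theory, and traces of representations *)

Section Representations.

Variables (F : fieldType) (gT : finGroupType).
Implicit Types G H N : {group gT}.

(* On a module with a trivial submodule and trivial quotient, the operators
   rG x - 1 have pairwise product zero, so N acts through an abelian group. *)
Lemma perfect_sub_rker_extension G N n (rG : mx_representation F G n)
    (U : 'M_n) (modU : mxmodule rG U) :
  N \subset N^`(1)%g -> N \subset rker (submod_repr modU) ->
  N \subset rker (factmod_repr modU) -> N \subset rker rG.
Proof.
move=> perfN kU kQ.
have sNG : N \subset G by apply: subset_trans kU (rstab_sub _ _).
have fixU x m (W : 'M_(m, n)) : x \in N -> (W <= U)%MS -> W *m rG x = W.
  move=> Nx; apply: rstab_act; rewrite -rker_submod; exact: (subsetP kU).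
have subU x : x \in N -> (rG x - 1%:M <= U)%MS.
  move=> Nx; have /rkerP[Gx rx1] := subsetP kQ x Nx.
  rewrite -in_factmod_eq0 linearB /= subr_eq0 -[rG x]mul1mx in_factmodJ //.
  by rewrite [factmod_mx _ _]rx1 mulmx1.
have mulN x y : x \in N -> y \in N -> rG (x * y)%g = rG x + rG y - 1%:M.
  move=> Nx Ny; rewrite repr_mxM ?(subsetP sNG) //.
  rewrite -{1}[rG x](subrK 1%:M) mulmxDl mul1mx fixU ?subU //.
  by rewrite addrAC.
apply: subset_trans perfN _; rewrite gen_subG.
apply/subsetP=> _ /imset2P[x y Nx Ny ->].
have [Gx Gy] := (subsetP sNG x Nx, subsetP sNG y Ny).
apply/rkerP; split; first by rewrite groupR.
(* Multiplying by [rG (y * x)] turns the claim into [rG (x * y) = rG (y * x)], and the formula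
   [mulN] is symmetric in [x] and [y]. *)
apply: (can_inj (mulKmx (repr_mx_unit rG (groupM Gy Gx)))).
rewrite mulmx1 -repr_mxM ?groupR ?groupM // commgEl conjgE.
have ->: (y * x * (x^-1 * (y^-1 * (x * y))) = x * y)%g.
  by rewrite !mulgA mulgK mulgV mul1g.
by rewrite !mulN // [rG x + _]addrC.
Qed.

(** Induction on the dimension: split off a simple submodule and glue it to the quotient by
    [perfect_sub_rker_extension]. *)
Lemma perfect_sub_rker_small G N m :
    N \subset N^`(1)%g ->
    (forall n (rG : mx_representation F G n),
       (n < m)%N -> mx_irreducible rG -> N \subset rker rG) ->
  forall n (rG : mx_representation F G n), N \subset G -> (n < m)%N ->
  N \subset rker rG.
Proof.
move=> perfN irrN n rG sNG; have [k] := ubnP n.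
elim: k => // k IHk in n rG * => lt_nk lt_nm.
have [n0 | n_gt0] := posnP n.
  apply/subsetP=> x Nx; apply/rkerP; split; first exact: (subsetP sNG).
  by apply/matrixP=> i; have:= ltn_ord i; rewrite {2}n0.
have nz1 : (1%:M : 'M[F]_n) != 0 by rewrite -mxrank_eq0 mxrank1 -lt0n.
(* Over an arbitrary field a simple submodule exists only classically, which is enough for a boolean
   goal. *)
apply: (mxsimple_exists (mxmodule1 rG) nz1) => [[U simU _]].
have [modU nzU _] := simU.
have rU_gt0 : (0 < \rank U)%N by rewrite lt0n mxrank_eq0.
apply: (perfect_sub_rker_extension (modU := modU)) => //.
  apply: irrN; last exact/submod_mx_irr.
  exact: leq_ltn_trans (rank_leq_row U) lt_nm.
have lt_n : (\rank (cokermx U) < n)%N by rewrite mxrank_coker ltn_subrL rU_gt0.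
by apply: IHk; [apply: leq_trans lt_n _ | apply: ltn_trans lt_n _].
Qed.

Lemma perfect_sub_rker_linear G N n (rG : mx_representation F G n) :
  N \subset N^`(1)%g -> N \subset G -> n = 1%N -> N \subset rker rG.
Proof.
move=> perfN sNG n1; apply: subset_trans (rker_linear rG n1).
exact: subset_trans perfN (dergS 1 sNG).
Qed.

(** By Clifford, the conjugates of [V] are simple of the same rank and span the whole space. Adding
    to a submodule [W] a conjugate not contained in it lowers the codimension by exactly [\rank V],
    until [W] is everything. So [\rank V] divides every codimension, in particular [n], and hence
    every rank. *)
Lemma mxrank_simple_dvd_module G N (nsNG : (N <| G)%g) n
    (rG : mx_representation F G n) (V : 'M_n) q (U : 'M_(q, n)) :
    mx_irreducible rG -> let rN := subg_repr rG (normal_sub nsNG) in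
    mxsimple rN V -> mxmodule rN U ->
  (\rank V %| \rank U)%N.
Proof.
move=> irrG rN simV modU.
have [X sXG [sumX _]] := Clifford_basis (nsHG := nsNG) irrG simV.
suffices dvd_sub (W : 'M_n) : mxmodule rN W -> (\rank V %| n - \rank W)%N.
  have dvn : (\rank V %| n)%N.
    by have := dvd_sub 0 (mxmodule0 rN n); rewrite mxrank0 subn0.
  rewrite -(subKn (rank_leq_col U)) dvdn_sub // -(mxrank_gen U) dvd_sub //.
  by rewrite (eqmx_module _ (genmxE U)).
have rankX x : x \in X -> \rank (V *m rG x) = \rank V.
  by move=> Xx; rewrite mxrankMfree // repr_mx_free // (subsetP sXG).
have [k] := ubnP (n - \rank W); elim: k => // k IHk in W * => lt_k modW.
have [/forall_inP sX | ] := boolP [forall x in X, (V *m rG x <= W)%MS].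
  have: (1%:M <= W)%MS by rewrite -sumX; apply/sumsmx_subP.
  by rewrite sub1mx => /eqP->; rewrite subnn.
rewrite negb_forall_in => /exists_inP[x Xx nsx].
have [modVx nzVx simVx] := Clifford_simple simV (subsetP sXG x Xx).
have capVW : (V *m rG x :&: W = 0)%MS.
  apply/eqP; apply: contraR nsx => nz.
  apply: submx_trans (capmxSr (V *m rG x) W).
  by apply: simVx; rewrite ?capmx_module ?capmxSl.
have rk : \rank (V *m rG x + W)%MS = (\rank V + \rank W)%N.
  by rewrite -(rankX x Xx) -mxrank_sum_cap capVW mxrank0 addn0.
have modS : mxmodule rN (V *m rG x + W)%MS by rewrite addsmx_module.
have rV_gt0 : (0 < \rank V)%N by have [_ ?] := simV; rewrite lt0n mxrank_eq0.
have le_n := rank_leq_col (V *m rG x + W)%MS; rewrite rk in le_n.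
have -> : (n - \rank W = \rank V + (n - (\rank V + \rank W)))%N.
  by rewrite addnBA // subnDl.
rewrite dvdn_addr // -rk; apply: IHk => //; rewrite rk.
have lt_WS : (\rank W < \rank V + \rank W)%N.
  by rewrite -[ltnLHS]add0n ltn_add2r.
rewrite ltnS in lt_k; apply: leq_trans lt_k.
by rewrite ltn_sub2l // (leq_trans lt_WS).
Qed.

Lemma mxtrace_mul_nondeg n (A : 'M[F]_n) :
  (forall B, \tr (A *m B) = 0) -> A = 0.
Proof.
move=> trA; apply/matrixP=> i j; rewrite mxE -(trA (delta_mx j i)).
rewrite mxtrace_mulC -(mul_delta_mx (0 : 'I_1)) -mulmxA mxtrace_mulC -mulmxA.
by rewrite trace_mx11 -colE -rowE !mxE.
Qed.

Lemma mxtrace_gring_mx G n1 (rG1 : mx_representation F G n1)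
    n2 (rG2 : mx_representation F G n2) :
    {in G, forall x, \tr (rG1 x) = \tr (rG2 x)} ->
  forall a, \tr (gring_mx rG1 a) = \tr (gring_mx rG2 a).
Proof.
move=> eq_tr a; rewrite /gring_mx /= !mulmx_sum_row !linear_sum /=.
apply: eq_bigr => i _.
by rewrite !linearZ /= !rowK !mxvecK eq_tr ?enum_valP.
Qed.

(* Equal traces make the annihilator of rG2 in the group algebra act on rG1 by
   matrices A with \tr (A *m B) = 0 for all B, so it also annihilates rG1.  As
   the enveloping algebra of rG1 has the largest possible dimension, both
   annihilators coincide, which identifies the two enveloping algebras. *)
Lemma mx_rsim_mxtrace G n1 (rG1 : mx_representation F G n1)
    n2 (rG2 : mx_representation F G n2) :
    n1 = n2 -> mx_absolutely_irreducible rG1 ->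
    {in G, forall x, \tr (rG1 x) = \tr (rG2 x)} ->
  mx_rsim rG1 rG2.
Proof.
move=> eq_n; case: n2 / eq_n rG2 => rG2; move: n1 rG1 rG2 => n rG1 rG2.
move=> absG1 eq_tr; have [n_gt0 fullE1] := andP absG1.
have eq_trg := mxtrace_gring_mx eq_tr.
have [L LE1] := row_fullP fullE1.
pose g1 := gring_mx rG1; pose g2 := gring_mx rG2.
(* [h] is a linear section of [g1], which is onto by absolute irreducibility. *)
pose h A := mxvec A *m L.
have hK A : g1 (h A) = A by rewrite /g1 /gring_mx /= -mulmxA LE1 mulmx1 mxvecK.
have ker21 a : g2 a = 0 -> g1 a = 0.
  move=> a0; apply: mxtrace_mul_nondeg => B.
  by rewrite -[B]hK -gring_mxA eq_trg gring_mxA -/(g2 a) a0 mul0mx mxtrace0.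
have gE m (rG : mx_representation F G m) a :
  (gring_mx rG a == 0) = (a <= kermx (enveloping_algebra_mx rG))%MS.
  by rewrite /gring_mx /= vec_mx_eq0; apply/eqP/sub_kermxP.
have ker12 a : g1 a = 0 -> g2 a = 0.
  move=> /eqP; rewrite gE => a0; apply/eqP; rewrite gE; apply: submx_trans a0 _.
  have sK : (kermx (enveloping_algebra_mx rG2)
               <= kermx (enveloping_algebra_mx rG1))%MS.
    by apply/row_subP=> i; rewrite -gE; apply/eqP/ker21/eqP; rewrite gE row_sub.
  rewrite -(mxrank_leqif_sup sK) eqn_leq mxrankS // !mxrank_ker leq_sub2l //.
  by rewrite (eqP fullE1) rank_leq_col.
(* By [ker12], [t] sends [g1 a] to [g2 a] for every [a], whichever preimage [h] picks. *)
pose t A := g2 (h A).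
have tJ A x : x \in G -> t (A *m rG1 x) = t A *m rG2 x.
  move=> Gx; rewrite /t /g2 -gring_mxJ //; apply/eqP.
  rewrite -subr_eq0 -linearB.
  apply/eqP/ker12; rewrite /g1 linearB /= gring_mxJ //.
  by rewrite -/g1 !hK subrr.
have t_lin : linear t.
  by move=> c A B; rewrite /t /h linearP mulmxDl -scalemxAl /g2 linearP.
have t_inj A : t A = 0 -> A = 0 by move/ker21; rewrite hK.
(* The matrices [dv *m v], supported on row [i0], form a copy of the module of [rG1]. Applying [t]
   and reading off a row that is nonzero at [A0] gives a nonzero homomorphism, injective by
   simplicity. *)
pose i0 := Ordinal n_gt0.
pose dv : 'cV[F]_n := delta_mx i0 0; pose A0 := dv *m (delta_mx 0 i0 : 'rV_n).
have nzA0 : A0 != 0.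
  apply/eqP=> /matrixP/(_ i0 i0)/eqP.
  by rewrite /A0 mul_delta_mx !mxE !eqxx oner_eq0.
have [i nzi] : exists i, row i (t A0) != 0.
  apply/existsP; apply: contraR nzA0; rewrite negb_exists => /forallP z.
  apply/eqP/t_inj/row_matrixP=> i; rewrite row0; apply/eqP.
  by have := z i; rewrite negbK.
pose f (v : 'rV[F]_n) : 'rV[F]_n := row i (t (dv *m v)).
have f_lin : linear f.
  by move=> c u v; rewrite /f linearP t_lin linearP.
pose fL : {linear _ -> _} := HB.pack f (GRing.isLinear.Build _ _ _ _ f f_lin).
pose B := lin1_mx fL.
have fE v : v *m B = f v by rewrite mul_rV_lin1.
have homB x : x \in G -> rG1 x *m B = B *m rG2 x.
  move=> Gx; apply/row_matrixP=> j; rewrite !rowE !mulmxA !fE /f mulmxA tJ //.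
  by rewrite row_mul.
exists B => //.
have [_ _ simG] := mx_abs_irrW absG1.
rewrite -kermx_eq0; apply: contraR nzi => nzK.
have modK : mxmodule rG1 (kermx B).
  apply/mxmoduleP=> x Gx; apply/sub_kermxP.
  by rewrite -mulmxA homB // mulmxA mulmx_ker mul0mx.
have /sub_kermxP := simG _ modK (submx1 _) nzK.
rewrite mul1mx => B0; have := fE (delta_mx 0 i0).
by rewrite B0 mulmx0 /f -/A0 => <-.
Qed.

End Representations.

(** * Induced representations as block matrices *)

Section InducedRepresentation.

Variables (F : fieldType) (gT : finGroupType) (G H : {group gT}).
Hypothesis sHG : H \subset G.

Local Notation k := #|rcosets H G|.

Definition rcoset_rep (i : 'I_k) : gT := repr (enum_val i).
Local Notation t := rcoset_rep.

Lemma rcoset_rep_in i : t i \in G.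
Proof.
have /rcosetsP[x Gx def_i] := enum_valP i; rewrite /t def_i.
by apply: subsetP (mem_repr_rcoset _ _); rewrite mul_subG ?sub1set.
Qed.

(** This yields that each block row of an induced matrix has exactly one nonzero block. *)
Lemma rcoset_repP y : y \in G ->
  exists j, forall j', (y * (t j')^-1 \in H)%g = (j' == j).
Proof.
move=> Gy; have Hy : (H :* y)%g \in rcosets H G by apply/rcosetsP; exists y.
exists (enum_rank_in Hy (H :* y)%g) => j'.
rewrite -mem_rcoset -(can_eq (enum_valK_in Hy)) enum_rankK_in //.
have /rcosetsP[x Gx def_x] := enum_valP j'.
have -> : (H :* t j' = enum_val j')%g by rewrite /t def_x rcoset_repr.
rewrite def_x eq_sym.
by apply/idP/eqP => [/rcoset_eqP|<-]; rewrite ?rcoset_refl.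
Qed.

Variables (n : nat) (rH : mx_representation F H n).

Definition ext0_repr x : 'M_n := if x \in H then rH x else 0.

(** The dimension stays a sum because [\mxblock] is typed that way; it equals the index of [H] times
    [n]. *)
Definition induced_mx x : 'M_(\sum_(i < k) n) :=
  \mxblock_(i < k, j < k) ext0_repr (t i * x * (t j)^-1)%g.

Lemma induced_mx_repr : mx_repr G induced_mx.
Proof.
split=> [|x y Gx Gy].
  rewrite /induced_mx -mxdiagZ; apply/eq_mxblock=> i j.
  have [l Pl] := rcoset_repP (rcoset_rep_in i).
  have := Pl i; rewrite mulgV group1 => /esym/eqP def_l.
  rewrite -def_l {l def_l} in Pl.
  rewrite /ext0_repr mulg1 Pl eq_sym; have [->|//] := eqVneq.
  by rewrite mulgV repr_mx1 conform_mx_id.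
rewrite mul_mxblock; apply/eq_mxblock=> i l.
have [j Pj] := rcoset_repP (groupM (rcoset_rep_in i) Gx).
rewrite (bigD1 j) //= big1 ?addr0 => [|j' nj]; last first.
  by rewrite {1}/ext0_repr Pj (negPf nj) mul0mx.
have Hj : (t i * x * (t j)^-1 \in H)%g by rewrite Pj.
have -> : (t i * (x * y) * (t l)^-1
             = (t i * x * (t j)^-1) * (t j * y * (t l)^-1))%g.
  by rewrite !mulgA mulgKV.
rewrite /ext0_repr groupMl // Hj; case: ifP => Hl; last by rewrite mulmx0.
by rewrite repr_mxM.
Qed.
Canonical induced_repr := MxRepresentation induced_mx_repr.

Lemma mxtrace_induced_repr x :
  \tr (induced_repr x) = \sum_i \tr (ext0_repr (t i * x * (t i)^-1)%g).
Proof. exact: mxtrace_mxblock. Qed.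

(** A basis of the [i]-th summand of the induced module, which is stable under the conjugate of [H]
    by [t i]. *)
Definition coset_block_row (i : 'I_k) : 'M[F]_(n, \sum_(j < k) n) :=
  \mxrow_(j < k) (if j == i then 1%:M else 0 : 'M[F]_n).

Lemma coset_block_row_free i : row_free (coset_block_row i).
Proof.
apply/row_freeP; exists (\mxcol_(j < k) (if j == i then 1%:M else 0 : 'M[F]_n)).
rewrite mul_mxrow_mxcol (bigD1 i) //= eqxx mulmx1 big1 ?addr0 // => j /negPf->.
exact: mul0mx.
Qed.

Lemma coset_block_row_induced i x :
    (t i * x * (t i)^-1)%g \in H -> x \in G ->
  coset_block_row i *m induced_repr x =
    rH (t i * x * (t i)^-1)%g *m coset_block_row i.
Proof.
move=> Hx Gx; rewrite mul_mxrow_mxblock mul_mxrow; apply: eq_mxrow => j.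
rewrite (bigD1 i) //= eqxx mul1mx.
rewrite big1 ?addr0 => [|j' /negPf->]; last exact: mul0mx.
have [l Pl] := rcoset_repP (groupM (rcoset_rep_in i) Gx).
have := Pl i; rewrite Hx => /esym/eqP def_l; rewrite -def_l {l def_l} in Pl.
rewrite /ext0_repr Pl; have [->|_] := eqVneq; first by rewrite mulmx1.
by rewrite mulmx0.
Qed.

(** In the permutation module, the sum of all cosets is fixed: each block column also has a single
    nonzero block. *)
Lemma mxrow1_induced x :
    (forall h, h \in H -> rH h = 1%:M) -> x \in G ->
  (\mxrow_(j < k) (1%:M : 'M_n)) *m induced_repr x = \mxrow_(j < k) 1%:M.
Proof.
move=> rH1 Gx; rewrite mul_mxrow_mxblock; apply: eq_mxrow => j.
have [i Pi] := rcoset_repP (groupM (rcoset_rep_in j) (groupVr Gx)).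
have inH i' : (t i' * x * (t j)^-1 \in H)%g = (i' == i).
  by rewrite -Pi -groupV !invMg !invgK mulgA.
rewrite (bigD1 i) //= mul1mx big1 ?addr0 => [|i' ni']; last first.
  by rewrite mul1mx /ext0_repr inH (negPf ni').
by rewrite /ext0_repr inH eqxx rH1 // inH.
Qed.

(** An element acting trivially has nonzero diagonal blocks; the block of the coset [H] itself,
    whose representative lies in [H], puts the element in [H]. *)
Lemma rker_induced_sub (N : {group gT}) :
  (0 < n)%N -> (N <| G)%g -> N \subset rker induced_repr -> N \subset H.
Proof.
move=> n_gt0 nsNG kN; apply/subsetP=> x Nx.
have [i Pi] := rcoset_repP (group1 G).
have Hti : t i \in H by have := Pi i; rewrite eqxx mul1g groupV.
have Gx := subsetP (normal_sub nsNG) x Nx.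
have := subsetP kN x Nx; rewrite inE mul1mx Gx /= => /eqP ix.
suffices: (t i * x * (t i)^-1 \in H)%g.
  by rewrite groupMr ?groupV // groupMl.
apply: contraTT isT => /negPf nHx.
have := congr1 (fun A => submxblock A i i) ix.
rewrite mxblockK /ext0_repr nHx -mxdiagZ submxblock_diag => /esym/eqP.
by rewrite -mxrank_eq0 mxrank1 => /eqP n0; rewrite n0 in n_gt0.
Qed.

End InducedRepresentation.

(** * Integral closedness of the algebraic integers *)

Lemma integralOver_Aint z : integralOver (intr : int -> algC) z -> z \in Aint.
Proof.
case=> q mon_q qz0; apply: root_monic_Aint qz0 (monic_map _ mon_q) _.
by apply/polyOverP=> i; rewrite coef_map /= intr_int.
Qed.

Lemma Aint_integralOver z : z \in Aint -> integralOver (intr : int -> algC) z.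
Proof.
move=> /floorpP[q def_q]; exists q; last by rewrite -def_q root_minCpoly.
apply/eqP/(@intr_inj algC).
rewrite -(lead_coef_map_inj (@intr_inj algC)) //= -def_q.
exact/monicP/minCpoly_monic.
Qed.

Lemma Aint_root (q : {poly algint}) z :
  q \is monic -> root (map_poly (val : algint -> algC) q) z -> z \in Aint.
Proof.
move=> mon_q qz0; apply: integralOver_Aint.
apply: integral_root_monic qz0 _; first exact: monic_map.
apply/integral_poly=> i; rewrite coef_map; exact: Aint_integralOver (valP _).
Qed.

Lemma char_poly_intertwine (R : fieldType) n (P A B : 'M[R]_n) :
  P \in unitmx -> P *m A = B *m P -> char_poly A = char_poly B.
Proof.
move=> uP PA; pose P' := map_mx (@polyC R) P.
have nzP : \det P' != 0 by rewrite det_map_mx polyC_eq0 -unitfE.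
apply: (mulfI nzP); rewrite /char_poly -det_mulmx [RHS]mulrC -det_mulmx.
by rewrite /char_poly_mx mulmxBr mulmxBl -!map_mxM PA scalar_mxC.
Qed.

(** * The residue field and the lifting of eigenvalues *)

Section Reduction.

Variables (p : nat) (M : mod_reduction p).
Local Notation F := (residue M).
Local Notation r := (red M).

(** Lift the coefficients to algebraic integers; the lifted monic polynomial has a root in [algC],
    integral by [Aint_root], whose reduction is a root. *)
Lemma residue_closed : GRing.closed_field_axiom F.
Proof.
move=> n c n_gt0.
pose b i := sval (sig_eqW (red_surj (c i))).
pose q : {poly algint} := 'X^n - \poly_(i < n) b i.
have szq : (size (\poly_(i < n) b i) < n.+1)%N by rewrite ltnS size_poly.
have mon_q : q \is monic.
  by rewrite monicE lead_coefDl ?lead_coefXn // size_polyXn size_polyN.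
have /closed_rootP[z qz0] : size (map_poly (val : algint -> algC) q) != 1%N.
  rewrite size_map_poly_id0 ?(monicP mon_q) ?oner_eq0 //.
  by rewrite size_polyDl size_polyXn ?size_polyN // eqSS -lt0n.
pose a := AlgInt (Aint_root mon_q qz0).
exists (r a); apply/eqP; rewrite -subr_eq0 -rmorphXn.
have : q.[a] = 0 by apply: val_inj; rewrite -horner_map; apply/rootP.
move=> /(congr1 r); rewrite rmorph0 hornerD hornerXn hornerN horner_poly.
rewrite rmorphB rmorph_sum.
move=> qa; rewrite -[X in _ == X]qa; apply/eqP; congr (_ - _).
apply: eq_bigr => i _; rewrite rmorphM rmorphXn.
by rewrite [r (b i)](svalP (sig_eqW (red_surj (c i)))).
Qed.

Lemma p'nat_residue_neq0 m : p^'.-nat m -> m%:R != 0 :> F.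
Proof.
have charF := red_pchar M; have pr_p := pcharf_prime charF.
by rewrite p'natE // (dvdn_pcharf charF).
Qed.

(** If [a] differs from 1, its powers below [m] sum to 0, but this sum reduces to [m], which is
    nonzero in the residue field. *)
Lemma red_root_of_unity_inj1 (a : algint) :
  p'_root_of_unity p a -> r a = 1 -> a = 1.
Proof.
case=> m p'm am1 ra1; apply/eqP; rewrite -subr_eq0; apply/eqP/val_inj.
have: (a - 1) * (\sum_(i < m) a ^+ i) = 0.
  by apply: val_inj; rewrite -subrX1 rmorphB rmorph1 rmorphXn /= am1 subrr.
move=> /(congr1 (val : algint -> algC))/eqP; rewrite rmorphM mulf_eq0.
case/orP=> /eqP // sum0.
have {}sum0 : \sum_(i < m) a ^+ i = 0 by apply: val_inj.
have := p'nat_residue_neq0 p'm; rewrite -(rmorph0 r) -sum0 rmorph_sum.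
under eq_bigr do rewrite rmorphXn ra1 expr1n.
by rewrite sumr_const card_ord eqxx.
Qed.

(** Reducing the factorization of ['X^m - 1] over the algebraic integers shows that [b] is the
    reduction of a power of [a]. *)
Lemma root_of_unity_lift m (b : F) :
  (0 < m)%N -> b ^+ m = 1 -> exists2 a : algint, a ^+ m = 1 & r a = b.
Proof.
move=> m_gt0 bm1; have [z prim_z] := C_prim_root_exists m_gt0.
pose a := AlgInt (Aint_prim_root prim_z).
have defX : \prod_(0 <= i < m) ('X - (a ^+ i)%:P) = 'X^m - 1.
  apply: (map_inj_poly val_inj (rmorph0 _)).
  pose iota : {rmorphism algint -> algC} := val.
  rewrite rmorph_prod rmorphB rmorph1 [X in _ = X - _](map_polyXn iota).
  rewrite -(factor_Xn_sub_1 prim_z).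
  by apply: eq_bigr => i _; rewrite [LHS](map_polyXsubC iota) rmorphXn.
have := congr1 (fun q => (map_poly r q).[b]) defX.
rewrite rmorph_prod rmorphB rmorph1 /= map_polyXn !hornerE bm1 subrr.
rewrite horner_prod.
move/eqP; rewrite prodf_seq_eq0 => /hasP[i _ /=].
rewrite map_polyXsubC hornerXsubC subr_eq0 => /eqP b_ai.
exists (a ^+ i) => //; apply: val_inj; rewrite !rmorphXn rmorph1 /= exprAC.
by rewrite (prim_expr_order prim_z) expr1n.
Qed.

Variable gT : finGroupType.
Implicit Types G H : {group gT}.

Lemma affords_brauer_exists G n (rG : mx_representation F G n) :
  exists phi : 'CF(G), affords_brauer rG phi.
Proof.
(* The list of roots is chosen from the polynomial alone, and [lift] depends only on the order and
   the root; conjugate elements therefore get equal values, making [f] a class function. *)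
pose roots q := sval (closed_axiom_poly_normal residue_closed q).
have liftP m (b : F) : exists a : algint,
    (0 < m)%N && (b ^+ m == 1) ==> (a ^+ m == 1) && (r a == b).
  have [/andP[m_gt0 /eqP bm1] | _] := boolP (_ && _); last by exists 0.
  have [a am1 ra] := root_of_unity_lift m_gt0 bm1.
  by exists a; rewrite am1 ra !eqxx.
pose lift m b := sval (sigW (liftP m b)).
pose f g := if (g \in G) && (p^'.-elt g)%g then
  \sum_(b <- roots (char_poly (rG g))) val (lift #[g]%g b) else 0.
have fJ : {in G &, forall x y, f (x ^ y)%g = f x}.
  move=> x y Gx Gy; rewrite /f groupJr // p_eltJ orderJ.
  congr (if _ then \sum_(b <- roots _) _ else _).
  apply: (@char_poly_intertwine _ _ (rG y)); first exact: repr_mx_unit.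
  by rewrite -!repr_mxM ?groupJ // -conjgC.
have f0 x : x \notin G -> f x = 0 by rewrite /f => /negPf->.
have fP : is_class_fun <<G>>%g [ffun x => f x].
  by rewrite genGid; exact: intro_class_fun.
exists (Cfun 0 fP) => g Gg; rewrite cfunE /f Gg /=.
case: ifP => p'g; last by rewrite p'g.
pose s := roots (char_poly (rG g)).
have def_s : char_poly (rG g) = \prod_(b <- s) ('X - b%:P).
  rewrite /s /roots; case: closed_axiom_poly_normal => /= u {1}->.
  by rewrite (monicP (char_poly_monic _)) scale1r.
have lift_s b : b \in s -> lift #[g]%g b ^+ #[g]%g = 1 /\ r (lift #[g]%g b) = b.
  move=> s_b; rewrite /lift; case: sigW => a /= /implyP aP.
  suffices: b ^+ #[g]%g == 1.
    by rewrite order_gt0 in aP => /aP/andP[/eqP-> /eqP].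
  have: root (char_poly (rG g)) b by rewrite def_s root_prod_XsubC.
  rewrite -eigenvalue_root_char => /eigenvalueP[v vg nz_v].
  have vgk k : v *m rG (g ^+ k)%g = b ^+ k *: v.
    elim: k => [|k IHk]; first by rewrite repr_mx1 mulmx1 scale1r.
    rewrite expgSr repr_mxM ?groupX // mulmxA IHk -scalemxAl vg scalerA.
    by rewrite -exprSr.
  have := vgk #[g]%g; rewrite expg_order repr_mx1 mulmx1 => /eqP.
  rewrite -subr_eq0 -{1}[v]scale1r -scalerBl scaler_eq0 (negPf nz_v) orbF.
  by rewrite subr_eq0 eq_sym.
exists [seq lift #[g]%g b | b <- s]; split.
- move=> _ /mapP[b /lift_s[am1 _] ->]; exists #[g]%g => //.
  by rewrite -(rmorphXn (val : algint -> algC)) am1 rmorph1.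
- rewrite big_map def_s; apply: eq_big_seq => b /lift_s[_ ->] //.
- by rewrite p'g big_map.
Qed.

Lemma affords_brauer1 G n (rG : mx_representation F G n) (phi : 'CF(G)) :
  affords_brauer rG phi -> phi 1%g = n%:R.
Proof.
move=> /(_ 1%g (group1 G)).
have -> : (p^'.-elt (1 : gT))%g by rewrite /p_elt order1.
case=> z [z1 def_p ->]; rewrite repr_mx1 in def_p.
have red_z a : a \in z -> r a = 1.
  move=> z_a; have: root (char_poly (1%:M : 'M[F]_n)) (r a).
    rewrite def_p -(big_map r xpredT (fun b => 'X - b%:P)) root_prod_XsubC.
    exact: map_f.
  rewrite -eigenvalue_root_char => /eigenvalueP[v]; rewrite mulmx1 => /eqP.
  rewrite -subr_eq0 -{1}[v]scale1r -scalerBl scaler_eq0 => /orP[|/eqP->].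
    by rewrite subr_eq0 => /eqP.
  by rewrite eqxx.
rewrite (eq_big_seq (fun=> 1)) => [|a z_a]; last first.
  by rewrite (red_root_of_unity_inj1 (z1 a z_a) (red_z a z_a)).
rewrite big_const_seq count_predT iter_addr_0 -(size_map r z).
by rewrite (@size_char_poly_roots _ _ (1%:M : 'M[F]_n)) // big_map.
Qed.

(** A relation, since [red] is defined on [algint] while character values lie in [algC]. *)
Definition reduces_to (c : algC) (b : F) : Prop :=
  exists2 a : algint, val a = c & r a = b.

Lemma affords_brauer_trace G n (rG : mx_representation F G n) (phi : 'CF(G)) g :
    affords_brauer rG phi -> g \in G -> (p^'.-elt g)%g ->
  reduces_to (phi g) (\tr (rG g)).
Proof.
move=> /(_ g) aff Gg p'g; rewrite p'g in aff; have [z [_ def_p ->]] := aff Gg.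
exists (\sum_(a <- z) a); first by rewrite rmorph_sum.
by rewrite (mxtrace_char_poly_roots (s := map r z)) ?big_map // rmorph_sum.
Qed.

End Reduction.

(** The summand is constant on each right coset of [H], so the factor [#|H|] cancels. The result
    matches [mxtrace_induced_repr] term by term. *)
Lemma cfInd_rcosets (gT : finGroupType) (G H : {group gT}) (psi : 'CF(H)) x :
    H \subset G ->
  'Ind[G] psi x =
    \sum_(i < #|rcosets H G|)
       psi (rcoset_rep i * x * (rcoset_rep i)^-1)%g.
Proof.
move=> sHG; rewrite cfIndE //.
have -> : \sum_(y in G) psi (x ^ y)%g = \sum_(y in G) psi (y * x * y^-1)%g.
  rewrite (reindex_inj invg_inj) /=.
  by apply: eq_big => y; rewrite ?groupV // conjgE invgK mulgA.
rewrite (set_partition_big _ (rcosets_partition sHG)) /=.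
rewrite [X in _ * X](eq_bigr (fun A : {set gT} =>
  #|H|%:R * psi (repr A * x * (repr A)^-1)%g)) => [|A HA].
  by rewrite -mulr_sumr mulKf ?neq0CG // big_enum_val.
have /rcosetsP[z Gz defA] := HA.
have Ar : repr A \in A by rewrite defA mem_repr_rcoset.
rewrite (eq_bigr (fun=> psi (repr A * x * (repr A)^-1)%g)) => [|y Ay].
  by rewrite sumr_const defA card_rcoset mulr_natl.
have eA : A = (H :* repr A)%g.
  by rewrite [LHS]defA; apply/esym/rcoset_eqP; rewrite -defA.
have Hh : (y * (repr A)^-1 \in H)%g by rewrite -mem_rcoset -eA.
rewrite -[RHS](cfunJ psi _ (groupVr Hh)) conjgE invgK invMg invgK.
by rewrite !mulgA !mulgKV.
Qed.

(** * Induced Brauer characters and the action of perfect normal subgroups *)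

Section PseudoMonomial.

Variables (p : nat) (M : mod_reduction p) (gT : finGroupType).
Implicit Types G H N : {group gT}.

Lemma mxtrace_affords_induced G H (sHG : H \subset G)
    n (rG : mx_representation (residue M) G n)
    m (rH : mx_representation (residue M) H m) (psi : 'CF(H)) :
    affords_brauer rG ('Ind[G] psi) -> affords_brauer rH psi ->
  {in G, forall x, \tr (rG x) = \tr (induced_repr sHG rH x)}.
Proof.
move=> affG affH x Gx; have charF := red_pchar M.
have trE := fun k (r : mx_representation (residue M) G k) =>
  mxtrace_repr_constt (@residue_closed p M) r charF Gx.
rewrite trE (trE _ (induced_repr sHG rH)) {trE}.
have Gs : (x.`_p^')%g \in G.
  by apply: subsetP (cycle_constt _ x); rewrite cycle_subG.
have p's : (p^'.-elt x.`_p^')%g := p_elt_constt _ x.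
move: (x.`_p^')%g Gs p's => s Gs p's.
have [a phi_a <-] := affords_brauer_trace affG Gs p's.
rewrite mxtrace_induced_repr.
(* Each term of the induction formula is lifted separately; where the conjugate leaves [H], both
   sides vanish and 0 is the lift. *)
have /fin_all_exists[b bP] (i : 'I_#|rcosets H G|) : exists b : algint,
    val b = psi (rcoset_rep i * s * (rcoset_rep i)^-1)%g /\
    red M b = \tr (ext0_repr rH (rcoset_rep i * s * (rcoset_rep i)^-1)%g).
  rewrite /ext0_repr; have [Hs | nHs] := boolP (_ \in H); last first.
    by exists 0; rewrite mxtrace0 cfun0 // !rmorph0.
  have p'sJ : (p^'.-elt (rcoset_rep i * s * (rcoset_rep i)^-1))%g.
    by rewrite -mulgA -[X in (X * _)%g]invgK -conjgE p_eltJ.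
  by have [b b1 b2] := affords_brauer_trace affH Hs p'sJ; exists b.
rewrite -(eq_bigr _ (fun i _ => (bP i).2)) -rmorph_sum; congr (red M _).
apply: val_inj; rewrite rmorph_sum [LHS]phi_a cfInd_rcosets //.
by apply: eq_bigr => i _; rewrite -[LHS](bP i).1.
Qed.

Lemma triv_mx_repr (F : fieldType) H : mx_repr H (fun _ => 1%:M : 'M[F]_1).
Proof. by split=> // x y _ _; rewrite mulmx1. Qed.

Lemma perfect_sub_small_index (F : fieldType) G H N n :
    H \subset G -> (N <| G)%g -> N \subset N^`(1)%g ->
    (forall m (rG : mx_representation F G m),
       (m < n)%N -> mx_irreducible rG -> N \subset rker rG) ->
    (1 < n)%N -> (#|G : H|%g <= n)%N ->
  N \subset H.
Proof.
move=> sHG nsNG perfN irrN n_gt1 le_n; have sNG := normal_sub nsNG.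
pose r1 := MxRepresentation (@triv_mx_repr F H).
pose rI := induced_repr sHG r1.
have dimI : (\sum_(i < #|rcosets H G|) 1 = #|G : H|%g)%N.
  by rewrite sum_nat_const muln1 card_ord.
apply: (@rker_induced_sub _ _ _ _ sHG _ r1) => //.
have small := perfect_sub_rker_small perfN irrN.
(* When the index is exactly [n], the fixed line is split off; [1 < n] makes both the line and the
   quotient smaller than [n]. *)
move: le_n; rewrite leq_eqVlt => /orP[/eqP eq_n | lt_n]; last first.
  by apply: small; rewrite ?dimI.
pose v : 'rV[F]_(\sum_(i < #|rcosets H G|) 1) := \mxrow_j 1%:M.
have fixv x : x \in G -> v *m rI x = v by apply: mxrow1_induced.
have nzv : v != 0.
  have [i _] := rcoset_repP H (group1 G).
  apply/eqP=> /(congr1 (fun A => submxrow A i)).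
  by rewrite mxrowK submxrow0 => /eqP; rewrite -mxrank_eq0 mxrank1.
have modv : mxmodule rI <<v>>%MS.
  by rewrite (eqmx_module _ (genmxE v)); apply/mxmoduleP=> x Gx; rewrite fixv.
have rkv : \rank <<v>>%MS = 1%N by rewrite mxrank_gen rank_rV nzv.
apply: (perfect_sub_rker_extension (modU := modv)) => //.
  by apply: small; rewrite ?rkv.
apply: small => //.
by rewrite mxrank_coker rkv dimI eq_n ltn_subrL (ltnW n_gt1).
Qed.

Lemma dim_induction_source G n (rG : mx_representation (residue M) G n)
    H m (rH : mx_representation (residue M) H m) (psi : 'CF(H)) :
    H \subset G -> affords_brauer rG ('Ind[G] psi) -> affords_brauer rH psi ->
  n = (#|G : H|%g * m)%N.
Proof.
move=> sHG /affords_brauer1 phi1 /affords_brauer1 psi1.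
apply/eqP; rewrite -(eqr_nat algC) natrM -phi1 -psi1.
by rewrite cfInd1.
Qed.

Lemma perfect_normal_sub_rker G N :
    pseudo_Mp_group M G -> (N <| G)%g -> N \subset N^`(1)%g ->
  forall n (rG : mx_representation (residue M) G n),
    mx_irreducible rG -> N \subset rker rG.
Proof.
move=> pseudoG nsNG perfN n; have [sNG nNG] := andP nsNG.
elim/ltn_ind: n => n IHn rG irrG.
have [n_gt0 _] := (mx_irrP rG).1 irrG.
have [n1 | n_neq1] := eqVneq n 1%N; first exact: perfect_sub_rker_linear.
have n_gt1 : (1 < n)%N by rewrite ltn_neqAle eq_sym n_neq1.
have [phi affG] := affords_brauer_exists rG.
have [_ gcd_max] := pseudoG phi (ex_intro _ n (ex_intro _ rG (conj irrG affG))).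
pose rN := subg_repr rG (normal_sub nsNG).
have nz1 : (1%:M : 'M[residue M]_n) != 0 by rewrite -mxrank_eq0 mxrank1 -lt0n.
apply: (mxsimple_exists (mxmodule1 rN) nz1) => [[V simV _]].
have rkV : \rank V = 1%N.
  apply/eqP; rewrite -dvdn1; apply: gcd_max => m [H [psi [[sHG]]]].
  case=> m' [rH [irrH affH]] def_phi psi1; rewrite -def_phi in affG.
  have {psi1} em : m' = m.
    by apply/eqP; rewrite -(eqr_nat algC) -psi1 (affords_brauer1 affH).
  case: m / em.
  have def_n := dim_induction_source sHG affG affH.
  have [m_gt0 _] := (mx_irrP rH).1 irrH.
  have sNH : N \subset H.
    apply: (perfect_sub_small_index sHG nsNG perfN _ n_gt1) => [m rm lt_m|].
      exact: IHn.
    by rewrite def_n leq_pmulr.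
  pose rI := induced_repr sHG rH.
  have absG := closed_axiom_closure_field (@residue_closed p M) irrG.
  have simGI : mx_rsim rG rI.
    apply: mx_rsim_mxtrace absG (mxtrace_affords_induced sHG affG affH).
    by rewrite sum_nat_const card_ord.
  have [B _ freeB homB] := mx_rsim_sym simGI.
  have [i _] := rcoset_repP H (group1 G).
  (* [S] is the image in [rG] of one summand of the induced module; it has rank [m'] and is stable
     under [N], as the conjugates of [N] lie in [H]. *)
  pose S := coset_block_row (residue M) m' i *m B.
  have <- : \rank S = m'.
    by rewrite mxrankMfree //; apply/eqP/coset_block_row_free.
  apply: (mxrank_simple_dvd_module irrG simV).
  apply/mxmoduleP=> x Nx; have Gx := subsetP sNG x Nx.
  have Hx : (rcoset_rep i * x * (rcoset_rep i)^-1)%g \in H.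
    apply: (subsetP sNH); rewrite -mulgA -[X in (X * _)%g]invgK -conjgE.
    by rewrite memJ_norm // (subsetP nNG) ?groupV // rcoset_rep_in.
  by rewrite -mulmxA -homB // mulmxA coset_block_row_induced // -mulmxA submxMl.
have [modV _ _] := simV.
have fixV : N \subset rstab rN V.
  by rewrite -(rker_submod modV); apply: perfect_sub_rker_linear.
(* [N] fixes [V] pointwise, hence by normality each conjugate of [V], and these span the space. *)
have [X sXG [sumX _]] := Clifford_basis (nsHG := nsNG) irrG simV.
have : (1%:M <= rfix_mx rG N)%MS.
  rewrite -sumX; apply/sumsmx_subP=> g Xg; have Gg := subsetP sXG g Xg.
  apply/rfix_mxP=> x Nx; have Gx := subsetP sNG x Nx.
  rewrite -mulmxA -repr_mxM // conjgCV repr_mxM ?groupJ ?groupV // mulmxA.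
  congr (_ *m _); apply: (rstab_act (rG := rN) (U := V)) => //.
  by apply: (subsetP fixV); rewrite memJ_norm // (subsetP nNG) ?groupV.
move/rfix_mxP=> fix1; apply/subsetP=> x Nx.
apply/rkerP; split; first exact: (subsetP sNG).
by have := fix1 x Nx; rewrite mul1mx.
Qed.

(** The derived series decreases strictly until it reaches a perfect term, which is normal and hence
    trivial. *)
Lemma solvable_perfect_normal G :
    (forall N, (N <| G)%g -> N \subset N^`(1)%g -> N :=: 1%g) ->
  solvable G.
Proof.
move=> perf1; suffices [l sl] : exists l, G^`(l)%g \subset G^`(l.+1)%g.
  by apply/derivedP; exists l; rewrite (perf1 _ (der_normal l G) sl).
have [m] := ubnP #|G^`(0)%g|; elim: m 0%N => // m IHm l lt_m.
have [sl | nsl] := boolP (G^`(l)%g \subset G^`(l.+1)%g); first by exists l.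
rewrite ltnS in lt_m; apply: (IHm l.+1); apply: leq_trans lt_m.
apply: proper_card.
by rewrite properE nsl andbT; apply: der_subS.
Qed.

End PseudoMonomial.

Theorem theorem2 (p : nat) (M : mod_reduction p) (gT : finGroupType)
    (G : {group gT}) :
  prime p -> 'O_p(G)%g = 1%g -> pseudo_Mp_group M G -> solvable G.
Proof.
move=> _ _ pseudoG; apply: solvable_perfect_normal => N nsNG perfN.
apply/trivgP; apply: subset_trans (regular_mx_faithful (residue M) G).
(* The bound [#|G|.+1] just exceeds the dimension of the regular module. *)
apply: (@perfect_sub_rker_small _ _ G N #|G|.+1) => //; last exact: normal_sub.
by move=> n rG _; apply: perfect_normal_sub_rker.
Qed.
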